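(* Let $C$ be an $A_\infty$-coalgebra. Then there is a functor $[C,-]:Vect^{\mathbb Z}\to\mathbf M_{[C,-]}$ from graded vector spaces to $A_\infty$-contramodules over $C$ (sending $W$ to the graded space $[C,W]$ with its canonical contramodule structure).
   Context: $K$ is a field; $Vect^{\mathbb Z}$ is the category of $\mathbb Z$-graded $K$-vector spaces, closed symmetric monoidal with internal hom $[W',W]_p=\prod_{k\in\mathbb Z}Vect(W'_k,W_{k+p})$. Koszul sign conventions apply. $A_\infty$-coalgebra: graded space $C$ with $w_k:C\to C^{\otimes k}$ of degree $2-k$ ($k\ge1$), $\sum_{p+q+r=n}(-1)^{pq+r}(1^{\otimes p}\otimes w_q\otimes1^{\otimes r})w_{p+1+r}=0$ for $n\ge1$ ($p,r\geq 0$, $q\geq 1$), and such that $\prod_kw_k:C\to\prod_kC^{\otimes k}$ factors through $\bigoplus_kC^{\otimes k}$. For $\bar n=(n_1,\dots,n_k)\in\mathbb Z^k$, $\Sigma\bar n=\sum n_i$, let $w_k(\bar n):C_{-\Sigma\bar n-(2-k)}\to C_{-n_1}\otimes\dots\otimes C_{-n_k}$ be the component of $w_k$, and define $w'_k:C\to C^{\otimes k}$ by the components $w'_k(\bar n):=(-1)^{k(\Sigma\bar n+1)}w_k(\bar n)$. An $A_\infty$-contramodule over $C$ is a graded space $M$ with maps $t^M_k:[C^{\otimes k-1},M]\to M$ of degree $2-k$ ($k\ge1$) such that for each $n\ge1$, $$\sum_{p+q+r=n,\,p\ge0,\,q,r\ge1}(-1)^{p+qr}t^M_{p+1+r}\circ[C^{\otimes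 p}\otimes w'_q\otimes C^{\otimes r-1},M]+\sum_{a+b=n,\,a\ge0,\,b\ge1}(-1)^at^M_{a+1}\circ[C^{\otimes a},t^M_b]=0,$$ where $[C^{\otimes a},[C^{\otimes b-1},M]]\cong[C^{\otimes a+b-1},M]$ is the isomorphism corresponding to right contramodules, identifying $F$ with $x\mapsto(y\mapsto F(x\otimes y))$, $x\in C^{\otimes a}$, $y\in C^{\otimes b-1}$. Morphisms are morphisms of graded spaces compatible with the structure maps; the category is $\mathbf M_{[C,-]}$. The canonical contramodule structure on $N=[C,W]$ is $t^N_k=[w'_k,W]:[C^{\otimes k-1},[C,W]]=[C^{\otimes k},W]\to[C,W]$. *)

(* Defs.v *)
From HB Require Import structures.
From mathcomp Require Import all_boot all_order all_algebra.
From mathcomp Require Import generic_quotient boolp zify.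

Set Implicit Arguments.
Unset Strict Implicit.
Unset Printing Implicit Defensive.

Import GRing.Theory.
Local Open Scope ring_scope.
Local Open Scope quotient_scope.

(** * Categories and functors *)

Record category := Category {
  obj :> Type;
  cat_hom : obj -> obj -> Type;
  cat_id : forall x, cat_hom x x;
  cat_comp : forall x y z, cat_hom y z -> cat_hom x y -> cat_hom x z;
  cat_idl : forall x y (f : cat_hom x y), cat_comp (cat_id y) f = f;
  cat_idr : forall x y (f : cat_hom x y), cat_comp f (cat_id x) = f;
  cat_compA : forall x y z t
      (f : cat_hom z t) (g : cat_hom y z) (h : cat_hom x y),
    cat_comp f (cat_comp g h) = cat_comp (cat_comp f g) h
}.

Record is_functor (A B : category) (F : A -> B)
    (Fm : forall x y : A, cat_hom x y -> cat_hom (F x) (F y)) : Prop :=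
  IsFunctor {
    functor_id : forall x : A, Fm x x (cat_id x) = cat_id (F x);
    functor_comp : forall (x y z : A) (f : cat_hom y z) (g : cat_hom x y),
      Fm x z (cat_comp f g) = cat_comp (Fm y z f) (Fm x y g)
  }.

(** * The vector space of linear maps *)

Section LinearMaps.
Variables (K : fieldType) (U V : lmodType K).

Definition mklin (f : U -> V) (fL : linear f) : {linear U -> V} :=
  HB.pack f (GRing.isLinear.Build K U V *:%R f fL).

Lemma mklinE f (fL : linear f) x : mklin fL x = f x. Proof. by []. Qed.

Lemma lin_ext (f g : {linear U -> V}) : f =1 g -> f = g.
Proof.
case: f g => f cf [g cg] /= /funext fg.
by rewrite fg in cf *; congr GRing.Linear.Pack; case: cf cg => [[a] [b]] [[a'] [b']];
   rewrite (Prop_irrelevance a a') (Prop_irrelevance b b').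
Qed.

End LinearMaps.

Section LinearMapsModule.
Variables (K : fieldType) (U V : lmodType K).
Local Notation L := {linear U -> V}.

HB.instance Definition _ := gen_eqMixin L.
HB.instance Definition _ := gen_choiceMixin L.

Definition lin0 : L := \0 : {linear U -> V}.
Definition linD (f g : L) : L := f \+ g : {linear U -> V}.
Definition linN (f : L) : L := \- f : {linear U -> V}.
Definition linZ (a : K) (f : L) : L := a \*: f : {linear U -> V}.

Fact linDA : associative linD.
Proof. by move=> f g h; apply: lin_ext => x; exact: addrA. Qed.
Fact linDC : commutative linD.
Proof. by move=> f g; apply: lin_ext => x; exact: addrC. Qed.
Fact lin0D : left_id lin0 linD.
Proof. by move=> f; apply: lin_ext => x; exact: add0r. Qed.
Fact linND : left_inverse lin0 linN linD.
Proof. by move=> f; apply: lin_ext => x; exact: addNr. Qed.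
HB.instance Definition _ := GRing.isZmodule.Build L linDA linDC lin0D linND.

Fact linZA a b f : linZ a (linZ b f) = linZ (a * b) f.
Proof. by apply: lin_ext => x; exact: scalerA. Qed.
Fact linZ1 : left_id 1 linZ.
Proof. by move=> f; apply: lin_ext => x; exact: scale1r. Qed.
Fact linZDr : right_distributive linZ +%R.
Proof. by move=> a f g; apply: lin_ext => x; exact: scalerDr. Qed.
Fact linZDl f : {morph linZ^~ f : a b / a + b}.
Proof. by move=> a b; apply: lin_ext => x; exact: scalerDl. Qed.
HB.instance Definition _ :=
  GRing.Zmodule_isLmodule.Build K L linZA linZ1 linZDr linZDl.

Lemma lin_lin a (f g : L) x : (a *: f + g) x = a *: f x + g x.
Proof. by []. Qed.

End LinearMapsModule.

(** * Vector spaces presented by generators and relations *)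

Section Presentation.
Variables (K : fieldType) (G : Type).

Inductive expr : Type :=
  | Gen of G
  | Zero
  | Add of expr & expr
  | Scale of K & expr.

Variable rel : expr -> expr -> Prop.

(* the least congruence containing [rel] and the vector space axioms *)
Inductive cong : expr -> expr -> Prop :=
  | cong_rel s t : rel s t -> cong s t
  | cong_refl s : cong s s
  | cong_sym s t : cong s t -> cong t s
  | cong_trans s t u : cong s t -> cong t u -> cong s u
  | cong_add s s' t t' : cong s s' -> cong t t' -> cong (Add s t) (Add s' t')
  | cong_scale a s s' : cong s s' -> cong (Scale a s) (Scale a s')
  | cong_addA s t u : cong (Add s (Add t u)) (Add (Add s t) u)
  | cong_addC s t : cong (Add s t) (Add t s)
  | cong_add0 s : cong (Add Zero s) s
  | cong_addN s : cong (Add (Scale (-1) s) s) Zero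
  | cong_scaleA a b s : cong (Scale a (Scale b s)) (Scale (a * b) s)
  | cong_scale1 s : cong (Scale 1 s) s
  | cong_scaleDr a s t :
      cong (Scale a (Add s t)) (Add (Scale a s) (Scale a t))
  | cong_scaleDl a b s :
      cong (Scale (a + b) s) (Add (Scale a s) (Scale b s)).

HB.instance Definition _ := gen_eqMixin expr.
HB.instance Definition _ := gen_choiceMixin expr.

Definition congb s t : bool := `[< cong s t >].

Fact congb_refl : reflexive congb.
Proof. by move=> s; apply/asboolP/cong_refl. Qed.
Fact congb_sym : symmetric congb.
Proof. by move=> s t; apply/asboolP/asboolP => /cong_sym. Qed.
Fact congb_trans : transitive congb.
Proof.
by move=> t s u /asboolP st /asboolP tu; apply/asboolP/(cong_trans st tu).
Qed.

Canonical cong_equiv := EquivRel congb congb_refl congb_sym congb_trans.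

Definition presented := {eq_quot cong_equiv}.
HB.instance Definition _ := Choice.on presented.

Definition cls (s : expr) : presented := \pi_(presented)%qT s.

Lemma clsP s t : cls s = cls t <-> cong s t.
Proof. by split=> [/eqP|st]; [rewrite eqmodE => /asboolP|apply/eqP; rewrite eqmodE; apply/asboolP]. Qed.

Lemma reprK_cls (x : presented) : cls (repr x) = x.
Proof. exact: reprK. Qed.

Lemma cong_repr s : cong (repr (cls s)) s.
Proof. by apply/clsP; rewrite reprK_cls. Qed.

Definition pres0 := cls Zero.
Definition presD (x y : presented) := cls (Add (repr x) (repr y)).
Definition presZ a (x : presented) := cls (Scale a (repr x)).
Definition presN (x : presented) := presZ (-1) x.

Lemma clsD s t : presD (cls s) (cls t) = cls (Add s t).
Proof. by apply/clsP; apply: cong_add; apply: cong_repr. Qed.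
Lemma clsZ a s : presZ a (cls s) = cls (Scale a s).
Proof. by apply/clsP; apply: cong_scale; apply: cong_repr. Qed.

Lemma clsW (P : presented -> Prop) : (forall s, P (cls s)) -> forall x, P x.
Proof. by move=> h x; rewrite -(reprK_cls x). Qed.

Fact presDA : associative presD.
Proof.
elim/clsW => s; elim/clsW => t; elim/clsW => u.
by rewrite !clsD; apply/clsP/cong_addA.
Qed.
Fact presDC : commutative presD.
Proof.
by elim/clsW => s; elim/clsW => t; rewrite !clsD; apply/clsP/cong_addC.
Qed.
Fact pres0D : left_id pres0 presD.
Proof. by elim/clsW => s; rewrite clsD; apply/clsP/cong_add0. Qed.
Fact presND : left_inverse pres0 presN presD.
Proof.
by elim/clsW => s; rewrite /presN clsZ clsD; apply/clsP/cong_addN.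
Qed.
HB.instance Definition _ :=
  GRing.isZmodule.Build presented presDA presDC pres0D presND.

Fact presZA a b x : presZ a (presZ b x) = presZ (a * b) x.
Proof. by elim/clsW: x => s; rewrite !clsZ; apply/clsP/cong_scaleA. Qed.
Fact presZ1 : left_id 1 presZ.
Proof. by elim/clsW => s; rewrite clsZ; apply/clsP/cong_scale1. Qed.
Fact presZDr : right_distributive presZ +%R.
Proof.
move=> a; elim/clsW => s; elim/clsW => t.
by rewrite [cls s + _]clsD !clsZ [RHS]clsD; apply/clsP/cong_scaleDr.
Qed.
Fact presZDl x : {morph presZ^~ x : a b / a + b}.
Proof.
elim/clsW: x => s a b.
by rewrite !clsZ [RHS]clsD; apply/clsP/cong_scaleDl.
Qed.
HB.instance Definition _ :=
  GRing.Zmodule_isLmodule.Build K presented presZA presZ1 presZDr presZDl.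

Definition gen (g : G) : presented := cls (Gen g).

Lemma cls_lin a s t : cls (Add (Scale a s) t) = a *: cls s + cls t.
Proof. by rewrite -[a *: _]/(presZ a (cls s)) clsZ [RHS]clsD. Qed.

Section Lift.
Variables (V : lmodType K) (f : G -> V).

Fixpoint eval (s : expr) : V :=
  match s with
  | Gen g => f g
  | Zero => 0
  | Add s t => eval s + eval t
  | Scale a s => a *: eval s
  end.

Hypothesis f_rel : forall s t, rel s t -> eval s = eval t.

Lemma eval_cong s t : cong s t -> eval s = eval t.
Proof.
elim=> {s t} //=.
- by move=> s t u _ -> _ ->.
- by move=> s s' t t' _ -> _ ->.
- by move=> a s s' _ ->.
- by move=> s t u; rewrite addrA.
- by move=> s t; rewrite addrC.
- by move=> s; rewrite add0r.
- by move=> s; rewrite scaleN1r addNr.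
- by move=> a b s; rewrite scalerA.
- by move=> s; rewrite scale1r.
- by move=> a s t; rewrite scalerDr.
- by move=> a b s; rewrite scalerDl.
Qed.

Lemma eval_repr s : eval (repr (cls s)) = eval s.
Proof. exact/eval_cong/cong_repr. Qed.

Fact lift_linear : linear (fun x : presented => eval (repr x)).
Proof.
move=> a; elim/clsW => s; elim/clsW => t.
by rewrite -cls_lin !eval_repr.
Qed.

Definition lift : {linear presented -> V} := locked (mklin lift_linear).

Lemma lift_gen g : lift (gen g) = f g.
Proof. by rewrite /lift -lock; exact: eval_repr. Qed.

End Lift.

Lemma gen_ext (V : lmodType K) (f g : {linear presented -> V}) :
  (forall x, f (gen x) = g (gen x)) -> f = g.
Proof.
move=> fg; apply: lin_ext; elim/clsW; elim=> [x||s IHs t IHt|a s IHs].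
- exact: fg.
- by rewrite -[cls Zero]/(0 : presented) !linear0.
- by rewrite -clsD -[presD _ _]/(cls s + cls t) !linearD IHs IHt.
- by rewrite -clsZ -[presZ _ _]/(a *: cls s) !linearZ /= IHs.
Qed.

End Presentation.

(** * Graded vector spaces *)

Definition grspace (K : fieldType) := int -> lmodType K.

Section Graded.
Variable K : fieldType.
Implicit Types V W X Y M N : grspace K.

Definition sgn (d : int) : K := (-1) ^ d.

(* Degree bookkeeping: [V m -> V n] is the identity when [m = n]. Being zero
   otherwise, it needs no proof of [m = n]; below it is applied only when the
   two degrees agree. *)
Definition regrade V m n (x : V m) : V n :=
  if m =P n is ReflectT e then ecast i (V i) e x else 0.

Lemma regrade_id V m (x : V m) : regrade m x = x.
Proof. by rewrite /regrade; case: eqP => // e; rewrite eq_axiomK. Qed.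

Fact regrade_linear V m n : linear (@regrade V m n).
Proof.
rewrite /regrade => a x y; case: eqP => [e|_]; last by rewrite scaler0 addr0.
by case: n / e.
Qed.
HB.instance Definition _ V m n :=
  GRing.isLinear.Build K (V m) (V n) *:%R (@regrade V m n) (@regrade_linear V m n).

(* degree-preserving maps, the morphisms of Vect^Z *)
Record grmor V W := GrMor { grmor_fun :> forall m, {linear V m -> W m} }.

Lemma grmor_ext V W (f g : grmor V W) : (forall m x, f m x = g m x) -> f = g.
Proof.
case: f g => f [g] /= fg; congr GrMor; apply: functional_extensionality_dep.
by move=> m; apply: lin_ext => x; apply: fg.
Qed.

Definition grid V : grmor V V := GrMor (fun m => idfun : {linear V m -> V m}).
Definition grcomp V W X (f : grmor W X) (g : grmor V W) : grmor V X :=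
  GrMor (fun m => f m \o g m : {linear V m -> X m}).

(* maps of degree d, the elements of [V, W]_d *)
Record grmap V W (d : int) :=
  GrMap { grmap_fun :> forall m, {linear V m -> W (m + d)} }.

Lemma grmap_ext V W d (f g : grmap V W d) :
  (forall m x, f m x = g m x) -> f = g.
Proof.
case: f g => f [g] /= fg; congr GrMap; apply: functional_extensionality_dep.
by move=> m; apply: lin_ext => x; apply: fg.
Qed.

Section GrMapModule.
Variables (V W : grspace K) (d : int).
Local Notation H := (grmap V W d).

HB.instance Definition _ := gen_eqMixin H.
HB.instance Definition _ := gen_choiceMixin H.

Definition grm0 : H := GrMap (fun m => 0).
Definition grmD (f g : H) : H := GrMap (fun m => f m + g m).
Definition grmN (f : H) : H := GrMap (fun m => - f m).
Definition grmZ (a : K) (f : H) : H := GrMap (fun m => a *: f m).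

Fact grmDA : associative grmD.
Proof. by move=> f g h; apply: grmap_ext => m x; exact: addrA. Qed.
Fact grmDC : commutative grmD.
Proof. by move=> f g; apply: grmap_ext => m x; exact: addrC. Qed.
Fact grm0D : left_id grm0 grmD.
Proof. by move=> f; apply: grmap_ext => m x; exact: add0r. Qed.
Fact grmND : left_inverse grm0 grmN grmD.
Proof. by move=> f; apply: grmap_ext => m x; exact: addNr. Qed.
HB.instance Definition _ := GRing.isZmodule.Build H grmDA grmDC grm0D grmND.

Fact grmZA a b f : grmZ a (grmZ b f) = grmZ (a * b) f.
Proof. by apply: grmap_ext => m x; exact: scalerA. Qed.
Fact grmZ1 : left_id 1 grmZ.
Proof. by move=> f; apply: grmap_ext => m x; exact: scale1r. Qed.
Fact grmZDr : right_distributive grmZ +%R.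
Proof. by move=> a f g; apply: grmap_ext => m x; exact: scalerDr. Qed.
Fact grmZDl f : {morph grmZ^~ f : a b / a + b}.
Proof. by move=> a b; apply: grmap_ext => m x; exact: scalerDl. Qed.
HB.instance Definition _ :=
  GRing.Zmodule_isLmodule.Build K H grmZA grmZ1 grmZDr grmZDl.

Lemma grmap_lin a (f g : H) m x : (a *: f + g) m x = a *: f m x + g m x.
Proof. by []. Qed.

End GrMapModule.

(* the internal hom [V, W] *)
Definition ghom V W : grspace K := fun d => grmap V W d.

(* [X, f] for f of degree 0 *)
Fact ghom_postmor_linear X M N (f : grmor M N) d :
  linear (fun F : ghom X M d =>
            GrMap (fun m => f (m + d) \o F m : {linear _ -> _}) : ghom X N d).
Proof. by move=> a F G; apply: grmap_ext => m x /=; rewrite linearP. Qed.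
Definition ghom_postmor X M N (f : grmor M N) : grmor (ghom X M) (ghom X N) :=
  GrMor (fun d => mklin (@ghom_postmor_linear X M N f d)).

(* [X, t] for t of degree e, F |-> t \o F *)
Fact ghom_post_linear X M N e (t : grmap M N e) d :
  linear (fun F : ghom X M d =>
            GrMap (fun m => @regrade N (m + d + e) (m + (d + e))
                              \o (t (m + d) \o F m) : {linear _ -> _})
            : ghom X N (d + e)).
Proof. by move=> a F G; apply: grmap_ext => m x /=; rewrite !linearP. Qed.
Definition ghom_post X M N e (t : grmap M N e) : grmap (ghom X M) (ghom X N) e :=
  GrMap (fun d => mklin (@ghom_post_linear X M N e t d)).

(* [g, M] for g : X -> Y of degree e, viewed as an operator x |-> x g acting
   from the right: g moves past F and x, so
     ([g, M] F)(x) = (-1)^(|g| (|F| + |x|)) F(x g). *)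
Fact ghom_pre_linear X Y e (g : grmap X Y e) M d :
  linear (fun F : ghom Y M d =>
            GrMap (fun m => sgn (e * (d + m))
                              \*: (@regrade M (m + e + d) (m + (d + e))
                                     \o (F (m + e) \o g m)) : {linear _ -> _})
            : ghom X M (d + e)).
Proof.
move=> a F G; apply: grmap_ext => m x /=.
by rewrite linearP /= scalerDr !scalerA mulrC.
Qed.
Definition ghom_pre X Y e (g : grmap X Y e) M : grmap (ghom Y M) (ghom X M) e :=
  GrMap (fun d => mklin (@ghom_pre_linear X Y e g M d)).

End Graded.
Arguments sgn {K}.
Arguments regrade {K V m} n x.

Program Definition grVect (K : fieldType) : category :=
  @Category (grspace K) (@grmor K) (@grid K) (@grcomp K) _ _ _.
Next Obligation. by move=> *; apply: grmor_ext. Qed.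
Next Obligation. by move=> *; apply: grmor_ext. Qed.
Next Obligation. by move=> *; apply: grmor_ext. Qed.

(** * Tensor powers *)

Section TensorPower.
Variables (K : fieldType) (C : grspace K).

(* a word (x_1, ..., x_k) of homogeneous elements stands for the tensor
   x_1 (x) ... (x) x_k *)
Definition word := seq {n : int & C n}.
Definition helem n (x : C n) : {n : int & C n} := existT _ n x.
Definition wdeg (u : word) : int := \sum_(x <- u) tag x.
Definition gword (k : nat) (m : int) :=
  {u : word | (size u == k) && (wdeg u == m)}.

Inductive tens_rel k m : expr K (gword k m) -> expr K (gword k m) -> Prop :=
  TensRel (u v : word) n a (x y : C n) (w wx wy : gword k m) of
      val w = u ++ helem (a *: x + y) :: v
    & val wx = u ++ helem x :: v
    & val wy = u ++ helem y :: v :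
    tens_rel (Gen K w) (Add (Scale a (Gen K wx)) (Gen K wy)).

(* (C^(x)k)_m, the direct sum of the C_{n_1} (x) ... (x) C_{n_k} over all
   n_1 + ... + n_k = m *)
Definition tpow (k : nat) : grspace K := fun m => presented (@tens_rel k m).

(* the tensor given by a word, or 0 if its length is not k or its degree not m *)
Definition tword k m (u : word) : tpow k m :=
  if insub u is Some w then gen (@tens_rel k m) w else 0.

Lemma wdeg_cat u v : wdeg (u ++ v) = wdeg u + wdeg v.
Proof. exact: big_cat. Qed.

Lemma wdeg_cons x v : wdeg (x :: v) = tag x + wdeg v.
Proof. exact: big_cons. Qed.

Lemma wdeg_slot u n (x : C n) v :
  wdeg (u ++ helem x :: v) = wdeg u + (n + wdeg v).
Proof. by rewrite wdeg_cat wdeg_cons. Qed.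

Lemma tword_val k m (w : gword k m) : tword k m (val w) = gen _ w.
Proof. by rewrite /tword valK. Qed.

Definition multilinear (k : nat) (L : lmodType K) (f : word -> L) :=
  forall u v n a (x y : C n), (size u + (size v).+1 = k)%N ->
    f (u ++ helem (a *: x + y) :: v)
      = a *: f (u ++ helem x :: v) + f (u ++ helem y :: v).

Lemma tword_multilinear k l m : multilinear l (@tword k m).
Proof.
move=> u v n a x y _; rewrite /tword.
have E z : (size (u ++ @helem n z :: v) == k) && (wdeg (u ++ @helem n z :: v) == m)
    = (size u + (size v).+1 == k)%N && (wdeg u + (n + wdeg v) == m).
  by rewrite size_cat wdeg_slot.
case Ew: ((size u + (size v).+1 == k)%N && (wdeg u + (n + wdeg v) == m)).
  have wP z : (size (u ++ @helem n z :: v) == k) && (wdeg (u ++ @helem n z :: v) == m).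
    by rewrite E.
  rewrite !(insubT (fun u => (size u == k) && (wdeg u == m)) (wP _)) /= -[RHS]cls_lin; apply/clsP/cong_rel.
  exact: (@TensRel k m u v n a x y).
by rewrite !insubF ?E // scaler0 addr0.
Qed.

Section TensorLift.
Variables (k : nat) (m : int) (L : lmodType K) (f : word -> L).
Hypothesis fM : multilinear k f.

Fact tlift_rel s t : @tens_rel k m s t ->
  eval (fun w : gword k m => f (val w)) s = eval (fun w => f (val w)) t.
Proof.
case=> u v n a x y w wx wy e ex ey /=; rewrite e ex ey fM //.
by move: (valP w); rewrite e size_cat => /andP[/eqP].
Qed.

Definition tlift : {linear tpow k m -> L} := lift tlift_rel.

Lemma tlift_word u : size u = k -> wdeg u = m -> tlift (tword k m u) = f u.
Proof.
move=> su du; have uP : (size u == k) && (wdeg u == m) by rewrite su du !eqxx.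
by rewrite /tword (insubT (fun u => (size u == k) && (wdeg u == m)) uP) [LHS]lift_gen.
Qed.
End TensorLift.

Lemma tpow_ext k m (L : lmodType K) (f g : {linear tpow k m -> L}) :
  (forall u, size u = k -> wdeg u = m -> f (tword k m u) = g (tword k m u)) ->
  f = g.
Proof.
move=> fg; apply: gen_ext => w; rewrite -tword_val.
by case/andP: (valP w) => /eqP ? /eqP ?; apply: fg.
Qed.

(* the product (C^(x)a)_i x (C^(x)b)_j -> (C^(x)(a+b))_(i+j); as for words, the
   target (k, m) is a parameter and the product is 0 unless it is (a+b, i+j) *)
Fact tword_cat_multilinear k m b (u : word) :
  multilinear b (fun v => tword k m (u ++ v)).
Proof.
by move=> v w n a x y _; rewrite !catA; apply: tword_multilinear erefl.
Qed.

Definition tmul_word k m b j (u : word) : {linear tpow b j -> tpow k m} :=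
  tlift j (@tword_cat_multilinear k m b u).

Fact tmul_multilinear k m a b j : multilinear a (@tmul_word k m b j).
Proof.
move=> u v n c x y _; apply: tpow_ext => w sw dw.
rewrite [RHS]lin_lin !tlift_word // -!catA !cat_cons.
exact: tword_multilinear erefl.
Qed.

Definition tmul k m a i b j : {linear tpow a i -> {linear tpow b j -> tpow k m}} :=
  tlift i (@tmul_multilinear k m a b j).

Arguments tmul : simpl never.

Lemma tmul_words k m a i b j u v :
  size u = a -> wdeg u = i -> size v = b -> wdeg v = j ->
  @tmul k m a i b j (tword a i u) (tword b j v) = tword k m (u ++ v).
Proof. by move=> *; rewrite /tmul tlift_word // /tmul_word tlift_word. Qed.

(* 1^p (x) f (x) 1^r for f : C -> C^(x)q of degree d, up to a sign s depending
   on the degrees of y and z: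
     y (x) x (x) z |-> s |y| |z| *: y (x) f(x) (x) z,
   where y and z are words of lengths p and r. The source is C^(x)k with
   k = p+1+r and the target is C^(x)l with l = p+q+r. *)
Section Slot.
Variables (s : int -> int -> K) (p q r l : nat) (d : int).
Variable f : grmap C (tpow q) d.

Definition slot_val m i j u n (x : C n) v : tpow l m :=
  s i j *: tmul l m (p + q) (i + (n + d)) r j
             (tmul (p + q) (i + (n + d)) p i q (n + d) (tword p i u) (f n x))
             (tword r j v).

Definition slot_word m (w : word) : tpow l m :=
  if drop p w is x :: v
  then slot_val m (wdeg (take p w)) (wdeg v) (take p w) (tagged x) v
  else 0.

Fact slot_multilinear k m : multilinear k (slot_word m).
Proof.
move=> u v n a x y _; rewrite /slot_word !take_cat !drop_cat.
case: ltnP => _.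
  case: (drop p u) => [|[n' x'] v'] /=; first by rewrite /slot_val !linearP.
  by rewrite !wdeg_slot /slot_val (tword_multilinear _ _ _ _ _ erefl) !linearP.
case: (p - size u)%N => [|t] /=; first by rewrite /slot_val !linearP.
case: (drop t v) => [|[n' x'] v']; first by rewrite scaler0 addr0.
rewrite !wdeg_slot /slot_val (tword_multilinear _ _ _ _ _ erefl).
by rewrite !linearP.
Qed.

Definition tslot k : grmap (tpow k) (tpow l) d :=
  GrMap (fun m => tlift m (@slot_multilinear k (m + d))).

End Slot.

(* f acts from the left: f(y (x) x (x) z) has the sign (-1)^(|f| |y|) *)
Definition tslotL p r q d (f : grmap C (tpow q) d) k l :
    grmap (tpow k) (tpow l) d :=
  tslot (fun i _ => sgn (d * i)) p r l f k.

(* f acts from the right: (y (x) x (x) z)f has the sign (-1)^(|f| |z|) *)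
Definition tslotR p r q d (f : grmap C (tpow q) d) k l :
    grmap (tpow k) (tpow l) d :=
  tslot (fun _ j => sgn (d * j)) p r l f k.

(* [C^(x)c, M] -> [C^(x)a, [C^(x)b, M]] for c = a+b, F |-> (x |-> (y |-> F(x (x) y))) *)
Fact curry_linear a b c M d (F : ghom (tpow c) M d) i :
  linear (fun x : tpow a i =>
     GrMap (fun j => @regrade K M (i + j + d) (j + (i + d))
                       \o (F (i + j) \o tmul c (i + j) a i b j x)
                     : {linear tpow b j -> _}) : ghom (tpow b) M (i + d)).
Proof.
move=> e x y; apply: grmap_ext => j z.
by rewrite [RHS]grmap_lin /= !(linearP, lin_lin).
Qed.

Definition curry a b c M d (F : ghom (tpow c) M d) :
    ghom (tpow a) (ghom (tpow b) M) d :=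
  GrMap (fun i => mklin (@curry_linear a b c M d F i)).

(* the inverse isomorphism [C^(x)k, [C, W]] -> [C^(x)(k+1), W],
   F |-> (x (x) y |-> F(x)(y)) *)
Section Uncurry.
Variables (k : nat) (W : grspace K).

Definition uncurry_val d (F : ghom (tpow k) (ghom C W) d) m i u n (y : C n) :
    W (m + d) :=
  regrade (m + d) (F i (tword k i u) n y).

Definition uncurry_word d (F : ghom (tpow k) (ghom C W) d) m (w : word) :
    W (m + d) :=
  if drop k w is y :: _
  then uncurry_val F m (wdeg (take k w)) (take k w) (tagged y) else 0.

Fact uncurry_multilinear d (F : ghom (tpow k) (ghom C W) d) m :
  multilinear k.+1 (uncurry_word F m).
Proof.
move=> u v n a x y sz; rewrite /uncurry_word !take_cat !drop_cat.
case: ltnP => [|_]; first by lia.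
case E: (k - size u)%N => [|t] /=; first by rewrite /uncurry_val !linearP.
case: (drop t v) => [|[n' x'] v']; first by rewrite scaler0 addr0.
rewrite !wdeg_slot /uncurry_val (tword_multilinear _ _ _ _ _ erefl).
by rewrite !linearP.
Qed.

Fact uncurry_linear d :
  linear (fun F : ghom (tpow k) (ghom C W) d =>
    GrMap (fun m => tlift m (@uncurry_multilinear d F m)) : ghom (tpow k.+1) W d).
Proof.
move=> a F G; apply: grmap_ext => m x.
suff E : tlift m (@uncurry_multilinear d (a *: F + G) m)
    = a *: tlift m (@uncurry_multilinear d F m)
      + tlift m (@uncurry_multilinear d G m) by rewrite grmap_lin /= E.
apply: tpow_ext => u su du.
rewrite lin_lin !tlift_word // /uncurry_word.
case: drop => [|[n y] v]; first by rewrite scaler0 addr0.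
by rewrite /uncurry_val grmap_lin linearP.
Qed.

Definition uncurry : grmor (ghom (tpow k) (ghom C W)) (ghom (tpow k.+1) W) :=
  GrMor (fun d => mklin (@uncurry_linear d)).

End Uncurry.
End TensorPower.

(** * A-infinity coalgebras *)

Section Coalgebra.
Variable K : fieldType.

(* [cow k] is w_(k+1); accordingly the sum runs over p + (q+1) + r = n *)
Definition ainf_relation (C : grspace K)
    (w : forall k : nat, grmap C (tpow C k.+1) (2 - k.+1%:Z)) : Prop :=
  forall (n : nat) (m : int) (x : C m),
    \sum_(p < n.+1) \sum_(q < n.+1) \sum_(r < n.+1 | (p + q.+1 + r == n)%N)
      sgn (p * q.+1 + r)%N *:
      regrade (m + (3 - n%:Z))
        (tslotL p r (w q) (p + r).+1 n _ (w (p + r)%N m x))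
    = 0 :> tpow C n (m + (3 - n%:Z)).

(* the map (w_k)_k to the product of the C^(x)k has values in the direct sum *)
Definition locally_finite (C : grspace K)
    (w : forall k : nat, grmap C (tpow C k.+1) (2 - k.+1%:Z)) : Prop :=
  forall (m : int) (x : C m),
    exists N : nat, forall k : nat, (N <= k)%N -> w k m x = 0.

Record ainf_coalgebra := AinfCoalgebra {
  coalg :> grspace K;
  cow : forall k : nat, grmap coalg (tpow coalg k.+1) (2 - k.+1%:Z);
  cow_relation : ainf_relation cow;
  cow_finite : locally_finite cow
}.

(* w'_k(n_1, ..., n_k) = (-1)^(k (n_1 + ... + n_k + 1)) w_k(n_1, ..., n_k); on
   C_m one has n_1 + ... + n_k = - (m + (2 - k)). Thus x w'_k is
   (-1)^(k |x|) w_k(x): w'_k is w_k written as an operator acting from the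
   right. *)
Definition cow' (C : ainf_coalgebra) (k : nat) :
    grmap C (tpow C k.+1) (2 - k.+1%:Z) :=
  GrMap (fun m => sgn (k.+1%:Z * (- (m + (2 - k.+1%:Z)) + 1)) \*: cow C k m
                  : {linear _ -> _}).

End Coalgebra.

(** * Contramodules *)

Section Contramodule.
Variables (K : fieldType) (C : ainf_coalgebra K).

(* [act k] is t_(k+1) *)
Record contra_data := ContraData {
  contra_space :> grspace K;
  act : forall k : nat,
    grmap (ghom (tpow C k) contra_space) contra_space (2 - k.+1%:Z)
}.

(* the relation for n+1; q, r, b stand for q-1, r-1, b-1 *)
Definition contra_relation (M : contra_data) : Prop :=
  forall (n : nat) (d : int) (F : ghom (tpow C n) M d),
    \sum_(p < n.+1) \sum_(q < n.+1) \sum_(r < n.+1 | (p + q.+1 + r == n)%N)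
      sgn (p + q.+1 * r.+1)%N *:
      regrade (d + (2 - n%:Z))
        (act M (p + r).+1 _
           (ghom_pre (tslotR p r (cow' C q) (p + r).+1 n) M d F))
    + \sum_(a < n.+1) \sum_(b < n.+1 | (a + b == n)%N)
        sgn a *:
        regrade (d + (2 - n%:Z))
          (act M a _ (ghom_post (tpow C a) (act M b) d (curry a b F)))
    = 0 :> contra_space M (d + (2 - n%:Z)).

Record contramodule := Contramodule {
  contra_of :> contra_data;
  contraP : contra_relation contra_of
}.

Definition contra_morph (M N : contra_data) (f : grmor M N) : Prop :=
  forall (k : nat) (d : int) (F : ghom (tpow C k) M d),
    f _ (act M k d F) = act N k d (ghom_postmor (tpow C k) f d F).

Record contra_hom (M N : contra_data) := ContraHom {
  hom_map :> grmor M N;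
  homP : contra_morph hom_map
}.

Lemma contra_hom_ext (M N : contra_data) (f g : contra_hom M N) :
  hom_map f = hom_map g -> f = g.
Proof.
by case: f g => f fP [g gP] /= e; rewrite e in fP *; congr ContraHom.
Qed.

Fact contra_id_morph (M : contra_data) : contra_morph (grid M).
Proof. by move=> k d F /=; congr (act M k d _); apply: grmap_ext. Qed.

Definition contra_id (M : contra_data) : contra_hom M M :=
  ContraHom (@contra_id_morph M).

Fact contra_comp_morph (M N P : contra_data)
    (f : contra_hom N P) (g : contra_hom M N) : contra_morph (grcomp f g).
Proof.
by move=> k d F /=; rewrite homP homP; congr (act P k d _); apply: grmap_ext.
Qed.

Definition contra_comp (M N P : contra_data)
    (f : contra_hom N P) (g : contra_hom M N) : contra_hom M P :=
  ContraHom (contra_comp_morph f g).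

Program Definition contramodules : category :=
  @Category contramodule contra_hom contra_id contra_comp _ _ _.
Next Obligation. by move=> *; apply/contra_hom_ext/grmor_ext. Qed.
Next Obligation. by move=> *; apply/contra_hom_ext/grmor_ext. Qed.
Next Obligation. by move=> *; apply/contra_hom_ext/grmor_ext. Qed.

(* [C, W] with t_k = [w'_k, W] : [C^(x)(k-1), [C, W]] = [C^(x)k, W] -> [C, W] *)
Definition hom_contra (W : grspace K) : contra_data :=
  @ContraData (ghom C W)
    (fun k => GrMap (fun d => ghom_pre (cow' C k) W d \o uncurry C k W d
                              : {linear _ -> _})).

End Contramodule.

(* Main.v *)
(* Identify F : C^(x)(k-1) -> [C, W] with its uncurried form F^ : C^(x)k -> W.
   The sign in the definition of w' is exactly the one that removes every sign
   depending on the degree of the argument, leaving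
     t_k(F) = (-1)^(k |F|) F^ o w_k.
   Likewise F o (1^p (x) w'_q (x) 1^(r-1)) uncurries to a global sign times
   F^ o (1^p (x) w_q (x) 1^r), and t_b o F to a global sign times
   F^ o (1^a (x) w_b). Hence the contramodule relation with index n for [C, W]
   is, up to the overall sign (-1)^((n-1) |F| + n), the coalgebra relation with
   index n composed with F^; its terms with r = 0 give the second sum. *)

Require Import Defs.
From mathcomp Require Import all_boot all_algebra.
From mathcomp Require Import zify.

Set Implicit Arguments.
Unset Strict Implicit.
Unset Printing Implicit Defensive.

Import GRing.Theory.
Local Open Scope ring_scope.

(** * Transport of degrees, signs, induction on tensors *)

Section GradedMaps.
Variable K : fieldType.

(** Degrees such as [m + d + e] and [m + (d + e)] are equal but not convertible. This and the next
    lemmas pull [regrade] outwards through maps and merge its iterates. *)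
Lemma regrade_regrade (V : grspace K) m k n (x : V m) :
  m = k -> regrade n (regrade k x) = regrade n x.
Proof. by move=> e; case: k / e; rewrite regrade_id. Qed.

Lemma grmap_regrade (V W : grspace K) d (f : grmap V W d) m n (x : V m) :
  m = n -> f n (regrade n x) = regrade (n + d) (f m x).
Proof. by move=> e; case: n / e; rewrite !regrade_id. Qed.

Lemma grmor_regrade (V W : grspace K) (f : grmor V W) m n (x : V m) :
  m = n -> f n (regrade n x) = regrade n (f m x).
Proof. by move=> e; case: n / e; rewrite !regrade_id. Qed.

Lemma regrade_ghom (V W : grspace K) d n (f : ghom V W d) m (x : V m) :
  d = n -> (regrade n f : ghom V W n) m x = regrade (m + n) (f m x).
Proof. by move=> e; case: n / e; rewrite !regrade_id. Qed.

Lemma ghom_sum (V W : grspace K) d I (s : seq I) (P : pred I)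
    (f : I -> grmap V W d) m (x : V m) :
  (\sum_(i <- s | P i) f i) m x = \sum_(i <- s | P i) f i m x.
Proof. by elim/big_rec2: _ => // i y g _ <-. Qed.

Lemma grmapZ (V W : grspace K) d a (f : grmap V W d) m (x : V m) :
  (a *: f) m x = a *: f m x.
Proof. by []. Qed.

Lemma ghom_preE (X Y : grspace K) e (g : grmap X Y e) M d (F : ghom Y M d) m x :
  ghom_pre g M d F m x
    = sgn (e * (d + m)) *: regrade (m + (d + e)) (F (m + e) (g m x)).
Proof. by []. Qed.

Lemma ghom_postE (X M N : grspace K) e (t : grmap M N e) d (F : ghom X M d) m x :
  ghom_post X t d F m x = regrade (m + (d + e)) (t (m + d) (F m x)).
Proof. by []. Qed.

Lemma sgnD i j : sgn (i + j) = sgn i * sgn j :> K.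
Proof. by rewrite /sgn expfzDr // oppr_eq0 oner_eq0. Qed.

Lemma odd_abszD (i j : int) : odd `|i + j| = odd `|i| (+) odd `|j|.
Proof. lia. Qed.

Lemma sgn_odd i : sgn i = (-1) ^+ odd `|i| :> K.
Proof.
by case: i => n; rewrite signr_odd // /sgn NegzE -exprz_inv invrN invr1.
Qed.

Lemma sgn_congr i j : odd `|i| = odd `|j| -> sgn i = sgn j :> K.
Proof. by rewrite !sgn_odd => ->. Qed.

(** Reduces identities linear in a tensor to words without packaging both sides as linear maps. A
    sum is read as [1 *: s + t] and a multiple as [a *: s + 0], so one closure condition
    suffices. *)
Lemma tpow_elim (C : grspace K) k m (P : tpow C k m -> Prop) :
    P 0 -> (forall a s t, P s -> P t -> P (a *: s + t)) ->
    (forall u, size u = k -> wdeg u = m -> P (tword k m u)) ->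
  forall t, P t.
Proof.
move=> P0 PL Pw; elim/clsW; elim=> [w||s IHs t IHt|a s IHs].
- have /andP[/eqP sw /eqP dw] := valP w.
  by rewrite -[cls _ _]/(gen _ w) -tword_val; apply: Pw.
- exact: P0.
- by rewrite -clsD -[X in P X]/(cls _ s + cls _ t) -[cls _ s]scale1r; apply: PL.
- by rewrite -clsZ -[X in P X]/(a *: cls _ s) -[X in P X]addr0; apply: PL.
Qed.

End GradedMaps.

(* The summands with [r = 0] of a coalgebra relation match the second sum of the
   contramodule relation, those with [r > 0] the first one. *)
Lemma sum_slots (V : nmodType) n (T : nat -> nat -> nat -> V) :
  \sum_(p < n.+2) \sum_(q < n.+2) \sum_(r < n.+2 | (p + q.+1 + r == n.+1)%N) T p q r
  = \sum_(p < n.+1) \sum_(q < n.+1) \sum_(r < n.+1 | (p + q.+1 + r == n)%N) T p q r.+1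
    + \sum_(a < n.+1) \sum_(b < n.+1 | (a + b == n)%N) T a b 0%N.
Proof.
(* The block has [q.+1] letters, so neither [p = n.+1] nor [q = n.+1] leaves an admissible [r]. *)
rewrite big_ord_recr /= [X in _ + X]big1 => [|q _]; last first.
  by rewrite big1 // => r; lia.
rewrite addr0 -big_split; apply: eq_bigr => p _ /=.
rewrite big_ord_recr /= [X in _ + X]big1 => [|r]; last by lia.
rewrite addr0 [X in _ = _ + X]big_mkcond -big_split; apply: eq_bigr => q _ /=.
rewrite big_mkcond big_ord_recl /= addrC [X in _ = X + _]big_mkcond.
congr (_ + _); first by apply: eq_bigr => r _; rewrite !addnS eqSS.
by rewrite addn0 addnS eqSS.
Qed.

(** Signs depend on exponents modulo 2 only: comparing them becomes a Boolean identity in the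
    parities of the atoms. *)
Ltac parity :=
  rewrite ?(odd_abszD, abszM, oddM, abszN) /= ?(oddD, oddM) /=;
  repeat match goal with |- context [odd ?n] => case: (odd n) end.

(** * Slot maps and uncurrying evaluated on words *)

Section Sandwich.
Variables (K : fieldType) (C : grspace K).

Lemma wdeg_rcons (u : word C) n (x : C n) : wdeg (u ++ [:: helem x]) = wdeg u + n.
Proof. by rewrite wdeg_slot /wdeg big_nil addr0. Qed.

(* With [r = 0] this splits off the last letter. *)
Lemma word_split p r (u : word C) : size u = (p + r).+1 ->
  exists y n (x : C n) z, [/\ u = y ++ helem x :: z, size y = p & size z = r].
Proof.
move=> su; move: (cat_take_drop p u) (size_drop p u); rewrite su.
case: (drop p u) => [|[n x] z] <- /= sz; first by lia.
exists (take p u), n, x, z; split=> //; last by lia.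
by rewrite size_takel // su; lia.
Qed.

Lemma sandwich_multilinear l m q (y z : word C) :
  multilinear q (fun v => tword l m (y ++ v ++ z)).
Proof.
move=> u v n a x x' _; rewrite -!catA !cat_cons !(catA y).
exact: tword_multilinear erefl.
Qed.

(* t |-> y (x) t (x) z *)
Definition sandwich l m q i y z : {linear tpow C q i -> tpow C l m} :=
  tlift i (@sandwich_multilinear l m q y z).

Lemma sandwich_word l m q i y z v : size v = q -> wdeg v = i ->
  sandwich l m q i y z (tword q i v) = tword l m (y ++ v ++ z).
Proof. by move=> *; rewrite /sandwich tlift_word. Qed.

(** Both nested products are concatenations, so by associativity they agree with [sandwich] once
    [f n x] is reduced to words. *)
Lemma tslot_word s p q r l d (f : grmap C (tpow C q) d) k m y n (x : C n) z :
    size y = p -> size z = r -> k = (p + r).+1 -> wdeg y + (n + wdeg z) = m ->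
  tslot s p r l f k m (tword k m (y ++ helem x :: z))
    = s (wdeg y) (wdeg z) *: sandwich l (m + d) q (n + d) y z (f n x).
Proof.
move=> sy sz -> dm; rewrite /= tlift_word; last 2 first.
- by rewrite size_cat /= sy sz addnS.
- by rewrite wdeg_slot.
rewrite /slot_word take_cat drop_cat -sy ltnn subnn take0 drop0 cats0.
rewrite /slot_val; congr (_ *: _).
elim/tpow_elim: (f n x) => [|a t t' IHt IHt'|v sv dv].
- by rewrite !linear0.
- by rewrite !(linearP, lin_lin) IHt IHt'.
by rewrite sandwich_word // !tmul_words ?catA // ?size_cat ?wdeg_cat ?sv ?dv.
Qed.

Lemma curryE a b c M d (F : ghom (tpow C c) M d) i x j z :
  curry a b F i x j z
    = regrade (j + (i + d)) (F (i + j) (tmul C c (i + j) a i b j x z)).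
Proof. by []. Qed.

Lemma uncurry_word_rcons W k d (F : ghom (tpow C k) (ghom C W) d) h m u n (y : C n) :
    size u = k -> wdeg u = h -> h + n = m ->
  uncurry C k W d F m (tword k.+1 m (u ++ [:: helem y]))
    = regrade (m + d) (F h (tword k h u) n y).
Proof.
move=> su <- dm; rewrite /= tlift_word; last 2 first.
- by rewrite size_cat /= su addn1.
- by rewrite wdeg_rcons.
by rewrite /uncurry_word take_cat drop_cat su ltnn subnn take0 drop0 cats0.
Qed.

(** The last letter [c] lies outside the block [t], so uncurrying peels it off and leaves the block
    to [F]. *)
Lemma uncurry_sandwich W n d (F : ghom (tpow C n) (ghom C W) d) h m q i
    y z j (c : C j) (t : tpow C q i) :
    (size y + q + size z)%N = n -> wdeg y + i + wdeg z = h -> h + j = m ->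
  uncurry C n W d F m (sandwich n.+1 m q i y (z ++ [:: helem c]) t)
    = regrade (m + d) (F h (sandwich n h q i y z t) j c).
Proof.
move=> sn dh dm; elim/tpow_elim: t => [|a t t' IHt IHt'|v sv dv].
- by rewrite !linear0.
- by rewrite !linearP IHt IHt'.
rewrite !sandwich_word // !catA; apply: uncurry_word_rcons => //.
- by rewrite !size_cat sv.
- by rewrite !wdeg_cat dv.
Qed.

(** Here the block contains the last letter: for [t] a word [v] followed by [c], both sides evaluate
    [F] at [y ++ v] and then at [c]. *)
Lemma uncurry_curry W n a b d (F : ghom (tpow C n) (ghom C W) d) h m i y
    (t : tpow C b.+1 i) :
    (a + b)%N = n -> size y = a -> wdeg y = h -> h + i = m ->
  uncurry C b W (h + d) (curry a b F h (tword a h y)) i t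
    = regrade (i + (h + d))
        (uncurry C n W d F m (sandwich n.+1 m b.+1 i y [::] t)).
Proof.
move=> sn sy dy dm; elim/tpow_elim: t => [|e t t' IHt IHt'|u su du].
- by rewrite !linear0.
- by rewrite !linearP IHt IHt'.
rewrite sandwich_word // cats0; move: du.
have [|v [j [c [[|? ?] [-> sv //]]]]] := @word_split b 0 u; first by rewrite addn0.
rewrite wdeg_rcons => _ dv.
rewrite (uncurry_word_rcons _ (h := wdeg v)) // curryE.
rewrite tmul_words // catA (uncurry_word_rcons _ (h := h + wdeg v)) //; last first.
- by rewrite -dm -dv addrA.
- by rewrite wdeg_cat dy.
- by rewrite size_cat sy sv.
rewrite regrade_ghom; last by lia.
by rewrite !regrade_regrade //; lia.
Qed.

End Sandwich.

(** * Uncurried terms of the contramodule relation *)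

Section HomContra.
Variables (K : fieldType) (C : ainf_coalgebra K) (W : grspace K).

Lemma cow'E k m (x : coalg C m) :
  cow' C k m x = sgn (k.+1%:Z * (- (m + (2 - k.+1%:Z)) + 1)) *: cow C k m x.
Proof. by []. Qed.

(* The sign in w' cancels the |x|-dependent part of the Koszul sign of [w', W]. *)
Lemma hom_actE k d (F : ghom (tpow C k) (ghom C W) d) m (x : coalg C m) :
  act (hom_contra C W) k d F m x
    = sgn ((2 - k.+1%:Z) * d) *:
      regrade (m + (d + (2 - k.+1%:Z))) (uncurry C k W d F _ (cow C k m x)).
Proof.
rewrite -[LHS]/(sgn _ *: regrade _ (uncurry C k W d F _ (sgn _ *: cow C k m x))).
move: (uncurry C k W d F) => U; rewrite !linearZ /= scalerA -sgnD.
by congr (_ *: _); apply: sgn_congr; parity.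
Qed.

(** The letter peeled off by uncurrying turns [r] into [r.+1]. For a word [y x z c], the signs of
    [ghom_pre], [tslotR] and [cow'] cancel in the degrees of [x] and [z]; what remains is the left
    Koszul sign in [wdeg y] and the global sign in [d]. *)
Lemma uncurry_slot p q r n d (F : ghom (tpow C n) (ghom C W) d) m t :
  (p + q.+1 + r = n)%N ->
  uncurry C (p + r).+1 W _ (ghom_pre (tslotR p r (cow' C q) (p + r).+1 n) _ d F) m t
  = sgn ((2 - q.+1%:Z) * d) *:
    regrade _ (uncurry C n W d F _ (tslotL p r.+1 (cow C q) (p + r).+2 n.+1 m t)).
Proof.
move=> E; elim/tpow_elim: t => [|a s t IHs IHt|u su du].
- by rewrite !linear0.
- by rewrite !linearP /= IHs IHt.
move: du; have [|y [i [x [v [-> sy sv]]]]] := @word_split _ _ p r.+1 u.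
  by rewrite addnS.
have [|z [j [c [[|? ?] [-> sz //]]]]] := @word_split _ _ r 0 v; first by rewrite addn0.
rewrite -cat_cons catA wdeg_rcons wdeg_slot => _ dm.
pose h := wdeg y + (i + wdeg z).
rewrite (uncurry_word_rcons _ (h := h)); first last.
- by rewrite /h; lia.
- by rewrite wdeg_slot.
- by rewrite size_cat /= sy sz addnS.
rewrite ghom_preE -catA cat_cons [tslotL _ _ _ _ _ _ _]tslot_word //; first last.
- by rewrite wdeg_rcons; lia.
- by rewrite addnS.
- by rewrite size_cat sz addn1.
rewrite [tslotR _ _ _ _ _ _ _]tslot_word // cow'E.
rewrite grmapZ regrade_ghom; last by lia.
rewrite !linearZ (uncurry_sandwich _ (h := h + (2 - q.+1%:Z))) //; [|lia..].
rewrite /= !scalerA -!sgnD !regrade_regrade; [|lia..].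
by congr (_ *: _); apply: sgn_congr; rewrite /h; parity.
Qed.

(** At a word [y], [curry a b F] takes a value of degree [wdeg y + d]; the [wdeg y] part of the sign
    from [hom_actE] is the Koszul sign of [tslotL]. *)
Lemma uncurry_post a b n d (F : ghom (tpow C n) (ghom C W) d) m t :
  (a + b = n)%N ->
  uncurry C a W _ (ghom_post (tpow C a) (act (hom_contra C W) b) d (curry a b F)) m t
  = sgn ((2 - b.+1%:Z) * d) *:
    regrade _ (uncurry C n W d F _ (tslotL a 0 (cow C b) a.+1 n.+1 m t)).
Proof.
move=> E; elim/tpow_elim: t => [|f s t IHs IHt|u su du].
- by rewrite !linear0.
- by rewrite !linearP /= IHs IHt.
move: du; have [|y [j [c [[|? ?] [-> sy //]]]]] := @word_split _ _ a 0 u.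
  by rewrite addn0.
rewrite wdeg_rcons => _ dm.
rewrite (uncurry_word_rcons _ (h := wdeg y)) // ghom_postE.
rewrite [tslotL _ _ _ _ _ _ _]tslot_word // ?addn0 ?[wdeg [::]]big_nil ?addr0 //.
rewrite regrade_ghom; last by lia.
rewrite hom_actE (uncurry_curry _ (m := m + (2 - b.+1%:Z))) //; last by lia.
(* Generalised first, because [/=] would expose the [tlift] inside [uncurry]. *)
move: (uncurry C n W d F) => U.
rewrite !linearZ /= !scalerA -!sgnD !regrade_regrade; [|lia..].
by congr (_ *: _); apply: sgn_congr; parity.
Qed.

End HomContra.

(** * Naturality and the contramodule relation *)

Section Canonical.
Variables (K : fieldType) (C : ainf_coalgebra K) (W : grspace K).

Lemma uncurry_postmor (W' : grspace K) (f : grmor W W') k d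
    (F : ghom (tpow C k) (ghom C W) d) m t :
  uncurry C k W' d (ghom_postmor (tpow C k) (ghom_postmor C f) d F) m t
    = f (m + d) (uncurry C k W d F m t).
Proof.
elim/tpow_elim: t => [|a s t IHs IHt|u su du].
- by rewrite !linear0.
- by rewrite !linearP IHs IHt.
move: du; have [|y [j [c [[|? ?] [-> sy //]]]]] := @word_split _ _ k 0 u.
  by rewrite addn0.
rewrite wdeg_rcons => _ dm.
rewrite !(uncurry_word_rcons _ (h := wdeg y)) // grmor_regrade //; lia.
Qed.

Lemma hom_contra_morph (W' : grspace K) (f : grmor W W') :
  @contra_morph K C (hom_contra C W) (hom_contra C W') (ghom_postmor C f).
Proof.
move=> k d F; apply: grmap_ext => m x.
rewrite [RHS]hom_actE uncurry_postmor.
rewrite -[LHS]/(f _ (act (hom_contra C W) k d F m x)) hom_actE.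
rewrite linearZ /= grmor_regrade //; lia.
Qed.

Lemma hom_contra_relation : contra_relation (hom_contra C W).
Proof.
move=> n d F; apply: grmap_ext => m x.
(* The arity [k] is kept apart from [p + r] so that [addnS] and [addn0] can rewrite it freely. *)
pose T (k p q r : nat) : tpow C n.+1 (m + (3 - n.+1%:Z)) :=
  sgn (p * q.+1 + r)%N *: regrade (m + (3 - n.+1%:Z))
    (tslotL p r (cow C q) k.+1 n.+1 _ (cow C k m x)).
pose Phi : {linear tpow C n.+1 (m + (3 - n.+1%:Z)) -> W (m + (d + (2 - n%:Z)))} :=
  regrade _ \o uncurry C n W d F _.
have PhiT k p q r : (p + q.+1 + r = n.+1)%N -> (p + r = k)%N ->
    Phi (T k p q r) = sgn (p * q.+1 + r)%N *: regrade (m + (d + (2 - n%:Z)))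
      (uncurry C n W d F _ (tslotL p r (cow C q) k.+1 n.+1 _ (cow C k m x))).
  move=> E ek; rewrite /Phi /T linearZ; congr (_ *: _).
  rewrite -[LHS]/(regrade _ (uncurry C n W d F _ _)) grmap_regrade; last by lia.
  by rewrite regrade_regrade //; lia.
have R := @cow_relation K C n.+1 m x.
rewrite (sum_slots _ (fun p q r => T (p + r)%N p q r)) in R.
(* The right-hand 0 is traded for the image of the coalgebra relation under [Phi], with the overall
   sign at index [n.+1], so that the sums match term by term. *)
have {R} := congr1 (fun t => sgn (n%:Z * d + n%:Z + 1) *: Phi t) R.
rewrite linear0 scaler0 => R; rewrite -[RHS]R {R}.
rewrite -[LHS]/((_ : grmap _ _ _) m x + (_ : grmap _ _ _) m x).
rewrite !ghom_sum linearD scalerDr; congr (_ + _); rewrite 2!linear_sum.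
  apply: eq_bigr => p _; rewrite ghom_sum 2!linear_sum.
  apply: eq_bigr => q _; rewrite ghom_sum 2!linear_sum.
  apply: eq_bigr => r /eqP E; rewrite addnS.
  rewrite grmapZ regrade_ghom; last by lia.
  rewrite hom_actE uncurry_slot // linearZ PhiT; [|lia..].
  move: (tslotL _ _ _ _ _ _ _) => t; move: (uncurry C n W d F) => U.
  rewrite !linearZ /= !scalerA -!sgnD !regrade_regrade; [|lia..].
  (* The two exponents agree modulo 2 only through the parity of [p + q.+1 + r = n]. *)
  by congr (_ *: _); apply: sgn_congr; move: (congr1 odd E); parity.
apply: eq_bigr => a _; rewrite ghom_sum 2!linear_sum.
apply: eq_bigr => b /eqP E; rewrite addn0.
rewrite grmapZ regrade_ghom; last by lia.
rewrite hom_actE uncurry_post // linearZ PhiT; [|lia..].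
move: (tslotL _ _ _ _ _ _ _) => t; move: (uncurry C n W d F) => U.
rewrite !linearZ /= !scalerA -!sgnD !regrade_regrade; [|lia..].
by congr (_ *: _); apply: sgn_congr; move: (congr1 odd E); parity.
Qed.

End Canonical.

Theorem proposition9p4 (K : fieldType) (C : ainf_coalgebra K) :
  exists (isContra : forall W : grVect K, contra_relation (hom_contra C W))
         (isMorph : forall (W W' : grVect K) (f : cat_hom W W'),
            @contra_morph K C (hom_contra C W) (hom_contra C W')
              (ghom_postmor C f)),
    @is_functor (grVect K) (contramodules C)
      (fun W => Contramodule (isContra W))
      (fun W W' f => ContraHom (isMorph W W' f)).
Proof.
exists (@hom_contra_relation K C), (@hom_contra_morph K C).
(* Postcomposition respects identities and composites by computation at each argument. *)
by split=> *; apply/contra_hom_ext/grmor_ext => d F; apply: grmap_ext.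
Qed.
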